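(* Let $d\ge2$, $\lambda_n>0$, $\beta_n\in\mathbb{R}$ ($n\ge0$), assume the Jacobi operator $J$ on $\ell^2(\Gamma_d)$ is not essentially selfadjoint, and let $z\in\mathbb{C}\setminus\mathbb{R}$. Let $y\in\Gamma_d$ have length $n$ and let $\{y_0,y_1,\dots,y_n\}$ be the unique path from the root $e=y_0$ to the vertex $y=y_n$. Then the Poisson kernel is given (as an element of $L^2(\Omega,d\omega)$ in the variable $\omega$) by $$P_z(y,\omega)=\frac{f_e(y)}{\alpha_0(z)}\,\mathbf{1}_{\Omega}(\omega)+\sum_{i=1}^n\frac{f_{y_i}(y)}{\alpha_i(z)}\,\sqrt{d^i}\,\Big[\mathbf{1}_{\Omega_{y_i}}(\omega)-\frac1d\,\mathbf{1}_{\Omega_{y_{i-1}}}(\omega)\Big].$$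
   Context: $\Gamma_d$ is the vertex set of the infinite rooted tree with root $e$ in which every vertex $x$ has exactly $d$ successors (children) $x_1,\dots,x_d$ and every $x\ne e$ has exactly one predecessor $x_0$; $|x|$ is the distance from $x$ to $e$; $\Gamma_x$ is the subtree consisting of $x$ and all its descendants. $J$ has domain the finitely supported functions in $\ell^2(\Gamma_d)$ and acts by $J\delta_x=\lambda_{n-1}\delta_{x_0}+\beta_n\delta_x+\lambda_n(\delta_{x_1}+\dots+\delta_{x_d})$, $n=|x|$, with the first term absent for $x=e$ ($\lambda_{-1}=0$). The deficiency space is $N_z(J)=(\operatorname{Im}(J-\bar zI))^{\perp}$. For $x\in\Gamma_d$ with $|x|=k$, $f_x:\Gamma_d\to\mathbb{C}$ vanishes outside $\Gamma_x$ and $f_x(y)=v_{|y|}$ for $y\in\Gamma_x$, where $v_k=1$, $zv_k=\beta_kv_k+d\lambda_kv_{k+1}$, $zv_n=\lambda_{n-1}v_{n-1}+\beta_nv_n+d\lambda_nv_{n+1}$ for $n>k$; since $J$ is not essentially selfadjoint, $f_x\in\ell^2(\Gamma_d)$. The norm $\|f_x\|$ depends only on $|x|$, and $\alpha_k(z)>0$ denotes its value for $|x|=k$. For $x\in\Gamma_d$ put $A_x=\{\sum_{i=1}^da_if_{x_i}: \sum a_i=0\}$, and $A_0=\mathbb{C}f_e$ (with $0\notin\Gamma_d$ an extra index). These spaces are pairwise orthogonal and their span is dense in $N_z(J)$. The boundary $\Omega$ is the set of infinite paths starting at $e$ and going downwards (each vertex followed by one of its successors), $\Omega_x$ is the set of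 those paths containing $x$, and $d\omega$ is the probability measure on $\Omega$ (infinite product of uniform measures on $d$ points) giving $\Omega_x$ mass $d^{-|x|}$. Put $B_x=\{\sum_{i=1}^db_i\mathbf{1}_{\Omega_{x_i}}:\sum b_i=0\}$ for $x\in\Gamma_d$, and $B_0=$ constants. These spaces are pairwise orthogonal with dense span in $L^2(\Omega,d\omega)$. The map $U:L^2(\Omega,d\omega)\to N_z(J)$ is the unique surjective linear isometry such that $U(\alpha_0(z)\mathbf{1}_\Omega)=f_e$ and, for every $x\in\Gamma_d$ and $a_i\in\mathbb{C}$ with $\sum_{i=1}^d a_i=0$, with $k=|x|+1$, $$U\Big(\alpha_k(z)\sqrt{d^k}\sum_{i=1}^da_i\mathbf{1}_{\Omega_{x_i}}\Big)=\sum_{i=1}^da_if_{x_i}.$$ For $y\in\Gamma_d$, the Poisson kernel $P_z(y,\cdot)\in L^2(\Omega,d\omega)$ is the unique function with $(UF)(y)=\int_\Omega P_z(y,\omega)F(\omega)\,d\omega$ for all $F\in L^2(\Omega,d\omega)$. *)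

(* Defs.v *)
From HB Require Import structures.
From mathcomp Require Import all_boot all_order all_algebra.
From mathcomp Require Import all_classical all_reals all_analysis.
From mathcomp Require Import ring.
From mathcomp.real_closed Require Import complex.
Set Implicit Arguments.
Unset Strict Implicit.
Unset Printing Implicit Defensive.
Import Order.TTheory GRing.Theory Num.Theory.
Import numFieldTopology.Exports numFieldNormedType.Exports.
Local Open Scope classical_set_scope.
Local Open Scope complex_scope.
Local Open Scope ring_scope.

(* A vertex of the d-ary tree is the word of the successor labels read along
   the path from the root to it: the root is [::], the successors of x are
   the words [rcons x i], |x| is [size x], and the subtree below x is
   [set y | prefix x y]. *)
Definition tree (d : nat) : Type := seq 'I_d.

Section Tree.
Variable d : nat.
Implicit Types x y : tree d.

Definition child x (i : 'I_d) : tree d := rcons x i.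

(* meaningful for x different from the root only *)
Definition parent x : tree d := take (size x).-1 x.

(* the i-th vertex on the path from the root to y, for i <= size y *)
Definition ancestor y (i : nat) : tree d := take i y.

Lemma parent_child x i : parent (child x i) = x.
Proof. by rewrite /parent /child size_rcons/= -cats1 take_size_cat. Qed.

Lemma ancestorS y i : (i < size y)%N ->
  exists j, ancestor y i.+1 = child (ancestor y i) j.
Proof.
case: y => [//|j0 s] ilt; exists (nth j0 (j0 :: s) i).
by rewrite /ancestor /child (take_nth j0).
Qed.

End Tree.

Section SquareSummable.
Variables (R : realType) (T : choiceType).
Implicit Types u v : T -> R[i].

Definition sqmod (z : R[i]) : R := complex.Re z ^+ 2 + complex.Im z ^+ 2.

Definition l2 : set (T -> R[i]) :=
  [set u | (\esum_(t in [set: T]) (sqmod (u t))%:E < +oo)%E].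

Definition l2norm u : R :=
  Num.sqrt (fine (\esum_(t in [set: T]) (sqmod (u t))%:E)).

(* sums of absolutely summable families *)
Definition rsum (a : T -> R) : R :=
  fine (\esum_(t in [set: T]) (Num.max (a t) 0)%:E)
  - fine (\esum_(t in [set: T]) (Num.max (- a t) 0)%:E).

Definition csum u : R[i] :=
  rsum (fun t => complex.Re (u t)) +i* rsum (fun t => complex.Im (u t)).

Definition l2dot u v : R[i] := csum (fun t => u t * conjc (v t)).

(* Operators in l2, not necessarily everywhere defined, are represented by
   their graphs. *)
Definition operator : Type := set ((T -> R[i]) * (T -> R[i])).

Definition op_closure (A : operator) : operator :=
  [set p | [/\ l2 p.1, l2 p.2 &
     exists s : nat -> (T -> R[i]) * (T -> R[i]),
     [/\ forall k, A (s k),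
         (fun k => l2norm (fun t => (s k).1 t - p.1 t)) @ \oo --> (0 : R) &
         (fun k => l2norm (fun t => (s k).2 t - p.2 t)) @ \oo --> (0 : R)]]].

Definition op_adjoint (A : operator) : operator :=
  [set q | [/\ l2 q.1, l2 q.2 &
     forall p, A p -> l2dot p.2 q.1 = l2dot p.1 q.2]].

Definition selfadjoint (A : operator) : Prop := op_adjoint A = A.

Definition essentially_selfadjoint (A : operator) : Prop :=
  selfadjoint (op_closure A).

End SquareSummable.

Section Jacobi.
Variables (R : realType) (d : nat) (lam bet : nat -> R).
Implicit Types (x y : tree d) (u : tree d -> R[i]) (z : R[i]).

Definition delta x : tree d -> R[i] := fun y => (x == y)%:R.

Definition finsupp : set (tree d -> R[i]) :=
  [set u | finite_set [set x | u x != 0]].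

Definition jacobi_delta x : tree d -> R[i] := fun y =>
  (if x == [::] then 0 else (lam (size x).-1)%:C * delta (parent x) y)
  + (bet (size x))%:C * delta x y
  + (lam (size x))%:C * \sum_(i < d) delta (child x i) y.

(* linear extension of [jacobi_delta] to finitely supported functions *)
Definition jacobi u : tree d -> R[i] := fun y =>
  \sum_(x \in [set: tree d]) (u x * jacobi_delta x y).

Definition jacobi_op : operator R (tree d) :=
  [set p | finsupp p.1 /\ p.2 = jacobi p.1].

Definition deficiency z : set (tree d -> R[i]) :=
  [set u | l2 u /\ forall w, finsupp w ->
     l2dot (fun y => jacobi w y - conjc z * w y) u = 0].

(* [fcoef z k m] is the coefficient v_{k+m} of the recurrence started at
   v_k = 1; see [fcoef1] and [fcoefSS]. *)
Fixpoint fcoef z (k m : nat) : R[i] :=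
  match m with
  | 0 => 1
  | m1.+1 =>
      ((z - (bet (k + m1))%:C) * fcoef z k m1
       - (if m1 is m2.+1 then (lam (k + m2))%:C * fcoef z k m2 else 0))
      / (d%:R * (lam (k + m1))%:C)
  end.

Definition ftree z x : tree d -> R[i] := fun y =>
  if prefix x y then fcoef z (size x) (size y - size x) else 0.

(* the norm of [ftree z x] for any x at level k, see [alphaE] *)
Definition alpha z (k : nat) : R :=
  l2norm (ftree z (xget ([::] : tree d) [set x | size x = k])).

Lemma fcoef1 z k : (0 < d)%N -> lam k != 0 ->
  z * fcoef z k 0 = (bet k)%:C * fcoef z k 0
                    + d%:R * (lam k)%:C * fcoef z k 1.
Proof.
move=> d0 lk; rewrite /= addn0 subr0 [X in _ + X]mulrC divfK; last first.
  by rewrite mulf_neq0 ?pnatr_eq0 -?lt0n// fmorph_eq0.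
by rewrite !mulr1 addrC subrK.
Qed.

Lemma fcoefSS z k m : (0 < d)%N -> lam (k + m.+1)%N != 0 ->
  z * fcoef z k m.+1 =
    (lam (k + m))%:C * fcoef z k m + (bet (k + m.+1))%:C * fcoef z k m.+1
    + d%:R * (lam (k + m.+1))%:C * fcoef z k m.+2.
Proof.
move=> d0 lk; rewrite [fcoef z k m.+2]/=.
rewrite -/(fcoef z k m.+1) [X in _ + X]mulrC divfK; last first.
  by rewrite mulf_neq0 ?pnatr_eq0 -?lt0n// fmorph_eq0.
by rewrite mulrBl; ring.
Qed.

End Jacobi.
Arguments jacobi_op {R} d lam bet.

Section Norms.
Variables (R : realType) (d : nat) (lam bet : nat -> R) (z : R[i]).
Implicit Types x : tree d.

Let esum_ftree x :
  (\esum_(y in [set: tree d]) (sqmod (ftree lam bet z x y))%:E =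
   \esum_(w in [set: tree d])
      (sqmod (fcoef d lam bet z (size x) (size w)))%:E)%E.
Proof.
transitivity (\esum_(y in cat x @` [set: tree d])
    (sqmod (ftree lam bet z x y))%:E)%E; last first.
  rewrite (@esum_image R (tree d) (tree d)); last first.
    by move=> v w _ _ /(congr1 (drop (size x))); rewrite !drop_size_cat.
  by apply: eq_esum => w _; rewrite /ftree prefix_prefix size_cat addKn.
rewrite [RHS]esum_mkcond; apply: eq_esum => y _.
case: ifPn => //; rewrite /ftree; case: ifPn => [/prefixP[w ->]|_ _].
  by move=> /negP[]; apply/mem_set; exists w.
by rewrite /sqmod/= expr0n/= addr0.
Qed.

Lemma alphaE x :
  l2norm (ftree lam bet z x) = alpha d lam bet z (size x).
Proof.
have E : size (xget ([::] : tree d) [set y | size y = size x]) = size x.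
  by apply: (@xgetPex _ _ [set y | size y = size x]); exists x.
by rewrite /alpha /l2norm !esum_ftree E.
Qed.

End Norms.

Section Boundary.
Variables (d : nat) (hd : (1 < d)%N).

(* A path going down from the root is the sequence of the labels of the
   successors it follows; the vertex it visits at level n is [mkseq w n]. The
   proof of 1 < d only serves to make the type pointed. *)
Definition boundary of (1 < d)%N : Type := nat -> 'I_d.

Definition path_vertex (w : boundary hd) (n : nat) : tree d := mkseq w n.

Definition shadow (x : tree d) : set (boundary hd) :=
  [set w | exists n, path_vertex w n = x].

HB.instance Definition _ := Choice.copy (boundary hd) (nat -> 'I_d).
HB.instance Definition _ :=
  isPointed.Build (boundary hd) (fun=> Ordinal (ltnW hd)).
HB.instance Definition _ :=
  Measurable.copy (boundary hd) (g_sigma_algebraType (range shadow)).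

End Boundary.
Arguments shadow {d} hd x.

Section L2complex.
Variables (R : realType) (disp : measure_display) (T : measurableType disp).
Variable mu : {measure set T -> \bar R}.
Implicit Types F G : T -> R[i].

Definition L2 : set (T -> R[i]) :=
  [set F | [/\ measurable_fun [set: T] (fun t => complex.Re (F t)),
               measurable_fun [set: T] (fun t => complex.Im (F t)) &
               (\int[mu]_t (sqmod (F t))%:E < +oo)%E]].

Definition L2norm F : R := Num.sqrt (fine (\int[mu]_t (sqmod (F t))%:E)%E).

Definition cintegral F : R[i] :=
  (\int[mu]_t complex.Re (F t)) +i* (\int[mu]_t complex.Im (F t)).

End L2complex.

Section Poisson.
Variables (R : realType) (d : nat) (hd : (1 < d)%N) (lam bet : nat -> R).
Variables (z : R[i]) (mu : probability (boundary hd) R).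
Implicit Types (F G P : boundary hd -> R[i]) (x y : tree d).

(* U acts on representatives of the classes in L2; linearity and isometry
   make it respect equality almost everywhere. *)
Record boundary_isometry
    (U : (boundary hd -> R[i]) -> (tree d -> R[i])) : Prop := {
  bi_range : forall F, L2 mu F -> deficiency lam bet z (U F);
  bi_linear : forall (c : R[i]) F G, L2 mu F -> L2 mu G ->
    U (fun w => c * F w + G w) = (fun y => c * U F y + U G y);
  bi_isometry : forall F, L2 mu F -> l2norm (U F) = L2norm mu F;
  bi_surjective : forall u, deficiency lam bet z u ->
    exists2 F, L2 mu F & U F = u;
  bi_root :
    U (fun w => (alpha d lam bet z 0)%:C * \1_[set: boundary hd] w)
    = ftree lam bet z [::];
  bi_branch : forall x (a : 'I_d -> R[i]), \sum_(i < d) a i = 0 ->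
    U (fun w =>
         (alpha d lam bet z (size x).+1 * Num.sqrt (d%:R ^+ (size x).+1))%:C
         * \sum_(i < d) a i * \1_(shadow hd (child x i)) w)
    = (fun y => \sum_(i < d) a i * ftree lam bet z (child x i) y)
}.

Definition poisson_kernel
    (U : (boundary hd -> R[i]) -> (tree d -> R[i])) y P : Prop :=
  L2 mu P /\
  forall F, L2 mu F -> U F y = cintegral mu (fun w => P w * F w).

End Poisson.

(* Main.v *)
Require Import Defs.
From mathcomp Require Import all_boot all_order all_algebra.
From mathcomp Require Import all_classical all_reals all_analysis.
From mathcomp Require Import measurable_realfun ring lra.
From mathcomp.real_closed Require Import complex.
Import Order.TTheory GRing.Theory Num.Theory.
Import numFieldTopology.Exports numFieldNormedType.Exports.
Import HBNNSimple.
Local Open Scope classical_set_scope.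
Local Open Scope complex_scope.
Local Open Scope ring_scope.

(* For fixed y, both F |-> (UF)(y) and the pairing of F with the claimed
   kernel are linear and bounded on L^2, the first one because U is isometric
   and point evaluation is bounded on l^2. They agree on constants and on each
   B_x: the increment of index i is orthogonal to B_x unless i = |x| + 1 and y
   lies below x, so at most one term of the kernel survives. By induction on |x|
   they agree on the indicators of the shadows, which form a pi-system
   generating the sigma-algebra, hence on a dense subspace. Uniqueness of the
   kernel follows by testing against the conjugate of the difference. *)

(** * Squared modulus of complex numbers *)

Section Sqmod.
Context {R : realType}.
Implicit Types a b : R[i].

Lemma sqmod_ge0 a : 0 <= sqmod a.
Proof. by rewrite /sqmod addr_ge0 ?sqr_ge0. Qed.

Lemma sqmod0 : sqmod (0 : R[i]) = 0.
Proof. by rewrite /sqmod /= expr0n addr0. Qed.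

Lemma sqmodN a : sqmod (- a) = sqmod a.
Proof. by case: a => x y; rewrite /sqmod/= !sqrrN. Qed.

Lemma sqmodM a b : sqmod (a * b) = sqmod a * sqmod b.
Proof. by case: a b => [a1 a2] [b1 b2]; rewrite /sqmod/=; ring. Qed.

(** By the parallelogram law the two sides differ by the squared modulus of [a - b]. This replaces
    the triangle inequality, so that no square roots are needed. *)
Lemma sqmodD_le a b : sqmod (a + b) <= 2 * sqmod a + 2 * sqmod b.
Proof.
case: a b => [a1 a2] [b1 b2]; rewrite /sqmod/= -subr_ge0.
suff -> : 2 * (a1 ^+ 2 + a2 ^+ 2) + 2 * (b1 ^+ 2 + b2 ^+ 2) -
  ((a1 + b1) ^+ 2 + (a2 + b2) ^+ 2) = (a1 - b1) ^+ 2 + (a2 - b2) ^+ 2.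
  by rewrite addr_ge0 ?sqr_ge0.
by ring.
Qed.

Lemma sqmod_eq0 a : sqmod a = 0 -> a = 0.
Proof.
case: a => [a1 a2]; rewrite /sqmod/= => /eqP.
by rewrite paddr_eq0 ?sqr_ge0// !sqrf_eq0 => /andP[/eqP-> /eqP->].
Qed.

Lemma sqmod_real (r : R) : sqmod r%:C = r ^+ 2.
Proof. by rewrite /sqmod/= expr0n addr0. Qed.

End Sqmod.

(** * Square-integrable complex functions and their bilinear pairing *)

Section L2Theory.
Context {R : realType} {disp : measure_display} {T : measurableType disp}.
Variable mu : {measure set T -> \bar R}.
Implicit Types F G H : T -> R[i].

Definition cintegrable F :=
  mu.-integrable [set: T] (EFin \o (fun t => complex.Re (F t))) /\
  mu.-integrable [set: T] (EFin \o (fun t => complex.Im (F t))).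

Lemma cintegral_lin (c : R[i]) F G : cintegrable F -> cintegrable G ->
  cintegral mu (fun t => c * F t + G t) =
  c * cintegral mu F + cintegral mu G.
Proof.
case: c => [a b] [iF1 iF2] [iG1 iG2]; rewrite /cintegral.
have iZ (r : R) (f : T -> R) : mu.-integrable setT (EFin \o f) ->
    mu.-integrable setT (EFin \o (fun t => r * f t)).
  by move=> fi; exact: (integrableZl measurableT r fi).
have -> : \int[mu]_t complex.Re ((a +i* b) * F t + G t) =
    \int[mu]_t (a * complex.Re (F t) - b * complex.Im (F t) + complex.Re (G t)).
  by apply: eq_Rintegral => t _; case: (F t) (G t) => [? ?] [? ?].
have -> : \int[mu]_t complex.Im ((a +i* b) * F t + G t) =
    \int[mu]_t (a * complex.Im (F t) + b * complex.Re (F t) + complex.Im (G t)).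
  by apply: eq_Rintegral => t _; case: (F t) (G t) => [? ?] [? ?].
rewrite RintegralD//; last first.
  exact: (integrableB measurableT (iZ _ _ iF1) (iZ _ _ iF2)).
rewrite RintegralB//; [|exact: iZ..].
rewrite RintegralD//; last first.
  exact: (integrableD measurableT (iZ _ _ iF2) (iZ _ _ iF1)).
rewrite RintegralD//; [|exact: iZ..].
by rewrite !RintegralZl//; simpc.
Qed.

Lemma measurable_sqmod F : measurable_fun setT (fun t => complex.Re (F t)) ->
  measurable_fun setT (fun t => complex.Im (F t)) ->
  measurable_fun setT (fun t => sqmod (F t)).
Proof.
by move=> m1 m2; apply: measurable_funD; apply: measurable_funX.
Qed.

Lemma L2_sqmod_integrable F : L2 mu F ->
  mu.-integrable [set: T] (EFin \o (fun t => sqmod (F t))).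
Proof.
case=> m1 m2 Foo; apply/integrableP; split.
  by apply/measurable_EFinP; exact: measurable_sqmod.
under eq_integral do rewrite /= ger0_norm ?sqmod_ge0//.
exact: Foo.
Qed.

Lemma L2P F : L2 mu F <->
  [/\ measurable_fun [set: T] (fun t => complex.Re (F t)),
      measurable_fun [set: T] (fun t => complex.Im (F t)) &
      mu.-integrable [set: T] (EFin \o (fun t => sqmod (F t)))].
Proof.
split=> [LF|[m1 m2 /integrableP[_]]].
  by have [m1 m2 _] := LF; split => //; exact: L2_sqmod_integrable.
under eq_integral do rewrite /= ger0_norm ?sqmod_ge0//.
by split.
Qed.

Lemma L2_lin c F G : L2 mu F -> L2 mu G -> L2 mu (fun t => c * F t + G t).
Proof.
move=> /L2P[m1 m2 iF] /L2P[n1 n2 iG].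
have M1 : measurable_fun setT (fun t => complex.Re (c * F t + G t)).
  rewrite (_ : (fun _ => _) = (fun t => complex.Re c * complex.Re (F t) -
      complex.Im c * complex.Im (F t) + complex.Re (G t))); last first.
    by apply/funext => t; case: c (F t) (G t) => [? ?] [? ?] [? ?].
  by apply: measurable_funD => //; apply: measurable_funB; apply: measurable_funM.
have M2 : measurable_fun setT (fun t => complex.Im (c * F t + G t)).
  rewrite (_ : (fun _ => _) = (fun t => complex.Re c * complex.Im (F t) +
      complex.Im c * complex.Re (F t) + complex.Im (G t))); last first.
    by apply/funext => t; case: {M1} c (F t) (G t) => [? ?] [? ?] [? ?].
  by apply: measurable_funD => //; apply: measurable_funD; apply: measurable_funM.
apply/L2P; split => //.
pose g t := (2 * sqmod c) * sqmod (F t) + 2 * sqmod (G t).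
apply: (@le_integrable _ _ _ _ _ _ _ (EFin \o g)) => //.
- by apply/measurable_EFinP; exact: measurable_sqmod.
- move=> t _; rewrite /= lee_fin !ger0_norm ?sqmod_ge0//.
    by rewrite /g -mulrA -sqmodM; exact: sqmodD_le.
  by rewrite /g addr_ge0// !mulr_ge0 ?sqmod_ge0.
- exact: (integrableD measurableT (integrableZl measurableT _ iF)
    (integrableZl measurableT _ iG)).
Qed.

Lemma L2_0 : L2 mu (fun=> 0).
Proof.
split; [exact: (measurable_cst (0 : R))..|].
by rewrite integral0_eq// => t _; rewrite sqmod0.
Qed.

Lemma L2Z c F : L2 mu F -> L2 mu (fun t => c * F t).
Proof.
move=> LF; have := L2_lin c _ _ LF L2_0.
by congr (L2 mu _); apply/funext => t; rewrite addr0.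
Qed.

Lemma L2D F G : L2 mu F -> L2 mu G -> L2 mu (fun t => F t + G t).
Proof.
move=> LF LG; have := L2_lin 1 _ _ LF LG.
by congr (L2 mu _); apply/funext => t; rewrite mul1r.
Qed.

Lemma L2B F G : L2 mu F -> L2 mu G -> L2 mu (fun t => F t - G t).
Proof.
move=> LF LG; have := L2_lin (-1) _ _ LG LF.
by congr (L2 mu _); apply/funext => t; rewrite mulN1r addrC.
Qed.

Lemma L2_sum (I : Type) (r : seq I) (F : I -> T -> R[i]) :
  (forall i, L2 mu (F i)) -> L2 mu (fun t => \sum_(i <- r) F i t).
Proof.
move=> LF; elim: r => [|i r IH].
  by under eq_fun do rewrite big_nil; exact: L2_0.
by under eq_fun do rewrite big_cons; exact: L2D.
Qed.

Lemma L2_conj F : L2 mu F -> L2 mu (fun t => conjc (F t)).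
Proof.
case=> m1 m2 Foo; split.
- rewrite (_ : (fun _ => _) = (fun t => complex.Re (F t)))//.
  by apply/funext => t; case: (F t).
- rewrite (_ : (fun _ => _) = (fun t => - complex.Im (F t))).
    exact: measurableT_comp.
  by apply/funext => t; case: (F t).
- rewrite (eq_integral (fun t => (sqmod (F t))%:E))// => t _.
  by case: (F t) => x y; rewrite /sqmod/= sqrrN.
Qed.

Lemma L2_mul_cintegrable F G : L2 mu F -> L2 mu G ->
  cintegrable (fun t => F t * G t).
Proof.
move=> /L2P[m1 m2 iF] /L2P[n1 n2 iG].
have D := integrableD measurableT iF iG.
split; apply: (le_integrable measurableT _ _ D) => //.
- apply/measurable_EFinP; rewrite (_ : (fun _ => _) = (fun t =>
    complex.Re (F t) * complex.Re (G t) - complex.Im (F t) * complex.Im (G t))).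
    by apply: measurable_funB; apply: measurable_funM.
  by apply/funext => t; case: (F t) (G t) => [? ?] [? ?].
- move=> t _ /=; rewrite lee_fin [leRHS]ger0_norm; last first.
    exact: addr_ge0 (sqmod_ge0 _) (sqmod_ge0 _).
  case: (F t) (G t) => [a b] [e f]; rewrite /sqmod/=; rewrite ler_norml.
  (* The squares of [a + e] and [b - f], and of [a - e] and [b + f], supply the cross terms of both
     signs that bound [a * e - b * f]. The imaginary part below is treated in the same way. *)
  have [] := (sqr_ge0 a, sqr_ge0 b); have [] := (sqr_ge0 e, sqr_ge0 f).
  have [] := (sqr_ge0 (a + e), sqr_ge0 (b - f)).
  have [] := (sqr_ge0 (a - e), sqr_ge0 (b + f)).
  by move=> *; apply/andP; split; lra.
- apply/measurable_EFinP; rewrite (_ : (fun _ => _) = (fun t =>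
    complex.Re (F t) * complex.Im (G t) + complex.Im (F t) * complex.Re (G t))).
    by apply: measurable_funD; apply: measurable_funM.
  by apply/funext => t; case: (F t) (G t) => [? ?] [? ?].
- move=> t _ /=; rewrite lee_fin [leRHS]ger0_norm; last first.
    exact: addr_ge0 (sqmod_ge0 _) (sqmod_ge0 _).
  case: (F t) (G t) => [a b] [e f]; rewrite /sqmod/=; rewrite ler_norml.
  have [] := (sqr_ge0 a, sqr_ge0 b); have [] := (sqr_ge0 e, sqr_ge0 f).
  have [] := (sqr_ge0 (a + f), sqr_ge0 (b + e)).
  have [] := (sqr_ge0 (a - f), sqr_ge0 (b - e)).
  by move=> *; apply/andP; split; lra.
Qed.

(* Cauchy-Schwarz; the [+ 1] removes the degenerate case from the choice of the
   parameter in [0 <= |t F + conj G|^2]. *)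
Lemma Rintegral_Re_sqr_le F G : L2 mu F -> L2 mu G ->
  (\int[mu]_t complex.Re (F t * G t)) ^+ 2 <=
  (\int[mu]_t sqmod (F t) + 1) * \int[mu]_t sqmod (G t).
Proof.
move=> LF LG; set r := Rintegral _ _ _; set s := Rintegral _ _ _.
set e := Rintegral _ _ _.
have [iF iG] := (L2_sqmod_integrable _ LF, L2_sqmod_integrable _ LG).
have [iR _] := L2_mul_cintegrable _ _ LF LG.
have s0 : 0 <= s by apply: Rintegral_ge0 => t _; exact: sqmod_ge0.
(* Up to the [+ 1], this is the minimizer of the quadratic polynomial t^2 s + 2 t r + e. *)
pose t := - r / (s + 1).
have iZ (a : R) (f : T -> R) : mu.-integrable setT (EFin \o f) ->
    mu.-integrable setT (EFin \o (fun t => a * f t)).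
  by move=> fi; exact: (integrableZl measurableT a fi).
have : 0 <= t ^+ 2 * s + 2 * t * r + e.
  rewrite -!RintegralZl// -RintegralD//; [|exact: iZ..].
  rewrite -RintegralD//; last first.
    exact: (integrableD measurableT (iZ _ _ iF) (iZ _ _ iR)).
  apply: Rintegral_ge0 => w _; case: (F w) (G w) => [a b] [c d].
  rewrite /sqmod/=.
  suff -> : t ^+ 2 * (a ^+ 2 + b ^+ 2) + 2 * t * (a * c - b * d) +
    (c ^+ 2 + d ^+ 2) = (t * a + c) ^+ 2 + (t * b - d) ^+ 2.
    by rewrite addr_ge0 ?sqr_ge0.
  by ring.
have s1 : 0 < s + 1 by lra.
have tE : t * (s + 1) = - r by rewrite /t divfK ?gt_eqF.
move=> h.
have : 0 <= (s + 1) * (t ^+ 2 * s + 2 * t * r + e) by rewrite mulr_ge0// ltW.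
have -> : (s + 1) * (t ^+ 2 * s + 2 * t * r + e) =
  t * (s + 1) * (t * (s + 1)) - t ^+ 2 * (s + 1) + 2 * (t * (s + 1)) * r + (s + 1) * e.
  by ring.
(* The nonnegative product is now (s + 1) e - r^2 - t^2 (s + 1); dropping the last term leaves the
   claim. *)
rewrite tE; have : 0 <= t ^+ 2 * (s + 1) by rewrite mulr_ge0 ?sqr_ge0// ltW.
nra.
Qed.

(** The factor 2 comes from bounding the real and imaginary parts separately. This is the continuity
    of the pairing in [G]. *)
Lemma sqmod_cintegral_le F G : L2 mu F -> L2 mu G ->
  sqmod (cintegral mu (fun t => F t * G t)) <=
  2 * (\int[mu]_t sqmod (F t) + 1) * \int[mu]_t sqmod (G t).
Proof.
move=> LF LG; have h1 := Rintegral_Re_sqr_le _ _ LF LG.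
(* Im (F G) = Re (- i F G) *)
have := Rintegral_Re_sqr_le _ _ (L2Z (- 'i) _ LF) LG.
under eq_Rintegral.
  move=> t _; rewrite (_ : complex.Re _ = complex.Im (F t * G t)).
  over.
  by case: (F t) (G t) => [a b] [c d] /=; ring.
under [X in X + 1]eq_Rintegral.
  move=> t _; rewrite sqmodM (_ : sqmod (- 'i : R[i]) = 1) ?mul1r.
  over.
  by rewrite /sqmod/=; ring.
by move=> h2; rewrite -mulrA mulr_natl mulr2n /sqmod/= lerD.
Qed.

Lemma L2_ae_eq0 F : L2 mu F -> \int[mu]_t sqmod (F t) = 0 ->
  {ae mu, forall t, F t = 0}.
Proof.
move=> LF I0; have iF := L2_sqmod_integrable _ LF.
have [m1 m2 _] := LF.
have ms : measurable_fun setT (EFin \o (fun t => sqmod (F t))).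
  by apply/measurable_EFinP; exact: measurable_sqmod.
have [h _] := ae_eq_integral_abs mu measurableT ms.
have {}/h : (\int[mu]_t `|(EFin \o (fun t => sqmod (F t))) t|)%E = 0%E.
  under eq_integral do rewrite /= ger0_norm ?sqmod_ge0//.
  by rewrite -(fineK (integrable_fin_num measurableT iF)); congr EFin.
by apply: filterS => t /(_ I)[/sqmod_eq0].
Qed.

Lemma ae_eq_cintegral F G : cintegrable F -> cintegrable G ->
  {ae mu, forall t, F t = G t} -> cintegral mu F = cintegral mu G.
Proof.
move=> [/integrableP[F1 _] /integrableP[F2 _]].
move=> [/integrableP[G1 _] /integrableP[G2 _]] FG.
by congr (_ +i* _); congr fine; apply: ae_eq_integral => //;
  apply: filterS FG => t /= ->.
Qed.

(* bilinear, not sesquilinear, as in the definition of the Poisson kernel *)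
Definition cpair F G := cintegral mu (fun t => F t * G t).

Lemma cpairC F G : cpair F G = cpair G F.
Proof. by congr cintegral; apply/funext => t; rewrite mulrC. Qed.

Lemma cpair_linr F c G H : L2 mu F -> L2 mu G -> L2 mu H ->
  cpair F (fun t => c * G t + H t) = c * cpair F G + cpair F H.
Proof.
move=> LF LG LH; rewrite /cpair -cintegral_lin; try exact: L2_mul_cintegrable.
by congr cintegral; apply/funext => t; rewrite mulrDr mulrCA.
Qed.

Lemma cpair0r F : cpair F (fun=> 0) = 0.
Proof.
rewrite /cpair/cintegral; under eq_Rintegral do rewrite mulr0.
under [X in _ +i* X]eq_Rintegral do rewrite mulr0.
by rewrite Rintegral_cst// mul0r.
Qed.

Lemma cpairZr F c G : L2 mu F -> L2 mu G ->
  cpair F (fun t => c * G t) = c * cpair F G.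
Proof.
move=> LF LG; have := cpair_linr _ c _ _ LF LG L2_0.
rewrite cpair0r addr0 => <-.
by congr (cpair F _); apply/funext => t; rewrite addr0.
Qed.

Lemma cpairDr F G H : L2 mu F -> L2 mu G -> L2 mu H ->
  cpair F (fun t => G t + H t) = cpair F G + cpair F H.
Proof.
move=> LF LG LH; have := cpair_linr _ 1 _ _ LF LG LH.
rewrite mul1r => <-.
by congr (cpair F _); apply/funext => t; rewrite mul1r.
Qed.

Lemma cpairBr F G H : L2 mu F -> L2 mu G -> L2 mu H ->
  cpair F (fun t => G t - H t) = cpair F G - cpair F H.
Proof.
move=> LF LG LH; have := cpair_linr _ (-1) _ _ LF LH LG.
rewrite mulN1r [RHS]addrC => <-.
by congr (cpair F _); apply/funext => t; rewrite mulN1r addrC.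
Qed.

Lemma cpair_sumr (I : Type) (r : seq I) F (G : I -> T -> R[i]) :
  L2 mu F -> (forall i, L2 mu (G i)) ->
  cpair F (fun t => \sum_(i <- r) G i t) = \sum_(i <- r) cpair F (G i).
Proof.
move=> LF LG; elim: r => [|i r IH].
  by rewrite big_nil -[RHS](cpair0r F); congr (cpair F _);
    apply/funext => t; rewrite big_nil.
rewrite big_cons -IH -cpairDr//; last exact: L2_sum.
by congr (cpair F _); apply/funext => t; rewrite big_cons.
Qed.

(** Since the pairing is bilinear, the squared norm is recovered by pairing with the conjugate;
    uniqueness of the kernel rests on this. *)
Lemma Re_cpair_conj F :
  complex.Re (cpair F (fun t => conjc (F t))) = \int[mu]_t sqmod (F t).
Proof.
by apply: eq_Rintegral => t _; case: (F t) => a b; rewrite /sqmod/=; ring.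
Qed.

End L2Theory.

(** * Closed subspaces of L2 containing the indicators of a generating pi-system *)

Section L2Density.
Context {R : realType} {disp : measure_display} {T : measurableType disp}.
Variable mu : probability T R.
Implicit Types (F H : T -> R[i]) (f : T -> R).

Lemma L2_le_real F f : L2 mu F -> measurable_fun setT f ->
  (forall t, f t ^+ 2 <= sqmod (F t)) -> L2 mu (fun t => (f t)%:C).
Proof.
move=> [m1 m2 Foo] mf fF; split; [exact: mf|exact: (measurable_cst (0 : R))|].
apply: le_lt_trans Foo; apply: ge0_le_integral => //.
- by move=> t _; rewrite lee_fin sqmod_ge0.
- by apply/measurable_EFinP; apply: measurable_sqmod => //; exact: (measurable_cst (0 : R)).
- by apply/measurable_EFinP; exact: measurable_sqmod.
- by move=> t _; rewrite lee_fin sqmod_real.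
Qed.

Lemma L2_1 : L2 mu (fun=> 1).
Proof.
split; [exact: (measurable_cst (1 : R))|exact: (measurable_cst (0 : R))|].
rewrite (_ : sqmod (1 : R[i]) = 1); last by rewrite /sqmod/= expr0n expr1n addr0.
by rewrite integral_cst//= mul1e -ge0_fin_numE// fin_num_measure.
Qed.

Lemma indic_complex (A : set T) :
  (\1_A : T -> R[i]) = (fun t => (\1_A t : R)%:C).
Proof. by apply/funext => t; rewrite !indicE; case: (t \in A). Qed.

Lemma L2_indic (A : set T) : measurable A -> L2 mu (\1_A : T -> R[i]).
Proof.
move=> mA; rewrite indic_complex; apply: (L2_le_real _ _ L2_1).
  exact: measurable_indic.
move=> t; rewrite /sqmod/= !expr0n addr0 indicE.
by case: (t \in A); rewrite ?expr0n ?expr1n.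
Qed.

(** [K] is later the set where two continuous linear functionals agree. Closedness is phrased with
    approximants in [K] at arbitrarily small squared distance, which is the form in which continuity
    is applied. *)
Variable K : set (T -> R[i]).
Hypothesis K1 : K (fun=> 1).
Hypothesis K_lin :
  forall (c : R[i]) F H, K F -> K H -> K (fun t => c * F t + H t).
Hypothesis K_closed : forall F, L2 mu F ->
  (forall e : R, 0 < e -> exists H, [/\ K H, L2 mu H &
     (\int[mu]_t (sqmod (F t - H t))%:E <= e%:E)%E]) -> K F.

Let K0 : K (fun=> 0).
Proof.
have := K_lin (-1) _ _ K1 K1.
by congr K; apply/funext => t; rewrite mulr1 addNr.
Qed.

Let KZ c F : K F -> K (fun t => c * F t).
Proof.
by move=> KF; have := K_lin c _ _ KF K0; congr K; apply/funext => t; rewrite addr0.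
Qed.

Let KD F H : K F -> K H -> K (fun t => F t + H t).
Proof.
by move=> KF KH; have := K_lin 1 _ _ KF KH; congr K; apply/funext => t;
  rewrite mul1r.
Qed.

Let K_sum (I : Type) (r : seq I) (F : I -> T -> R[i]) :
  (forall i, K (F i)) -> K (fun t => \sum_(i <- r) F i t).
Proof.
move=> KF; elim: r => [|i r IH]; first by under eq_fun do rewrite big_nil.
by under eq_fun do rewrite big_cons; exact: KD.
Qed.

(** As 0 <= f - s n <= f, the squares of the differences are dominated by the integrable f^2, so
    pointwise convergence implies convergence in L2. *)
Let K_dominated (s : nat -> T -> R) f : L2 mu (fun t => (f t)%:C) ->
  (forall n, measurable_fun setT (s n)) ->
  (forall n t, 0 <= s n t <= f t) ->
  (forall t, s n t @[n --> \oo] --> f t) ->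
  (forall n, K (fun t => (s n t)%:C)) -> K (fun t => (f t)%:C).
Proof.
move=> Lf ms sf cs Ks; apply: K_closed => // e e0.
have [mf _ ifoo] := Lf.
have Ls n : L2 mu (fun t => (s n t)%:C).
  apply: L2_le_real Lf (ms n) _ => t; rewrite sqmod_real.
  by have /andP[? ?] := sf n t; rewrite ler_sqr ?nnegrE//; lra.
have cv : (\int[mu]_t (sqmod ((f t)%:C - (s n t)%:C))%:E)%E @[n --> \oo] --> 0%E.
  rewrite -(@integral0 _ _ _ mu setT).
  apply: (@dominated_cvg _ _ _ mu _ measurableT _ _
    (EFin \o (fun t => sqmod (f t)%:C))) => //.
  - move=> n; apply/measurable_EFinP.
    by have [? ? _] := L2B mu _ _ Lf (Ls n); exact: measurable_sqmod.
  - move=> t _; apply: cvg_EFin; first by near=> n.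
    rewrite [X in X @ _ --> _](_ : _ = (fun n => (f t - s n t) ^+ 2)).
      rewrite [X in _ --> X](_ : 0 = (f t - f t) ^+ 2); last by rewrite subrr expr0n.
      rewrite expr2; under eq_fun do rewrite expr2.
      by apply: cvgM; apply: cvgB => //; exact: cvg_cst.
    by apply/funext => n; rewrite /= -rmorphB sqmod_real.
  - exact: L2_sqmod_integrable.
  - move=> n t _; rewrite /= lee_fin ger0_norm ?sqmod_ge0// -rmorphB !sqmod_real.
    by have /andP[? ?] := sf n t; rewrite ler_sqr ?nnegrE; lra.
have : \forall n \near \oo,
    (\int[mu]_t (sqmod ((f t)%:C - (s n t)%:C))%:E < e%:E)%E.
  apply: (cv [set x | (x < e%:E)%E]); rewrite /nbhs/=.
  near=> r; rewrite /= lte_fin; near: r; exact: lt_nbhsl.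
by move=> [n _ /(_ n (leqnn n)) h]; exists (fun t => (s n t)%:C); split => //; exact: ltW.
Unshelve. all: by end_near. Qed.

(** Dynkin's argument: the measurable sets with indicator in [K] form a lambda-system, since proper
    differences are handled by linearity and increasing unions by [K_dominated]. *)
Let K_indic (G : set (set T)) : setI_closed G ->
  G `<=` measurable -> @measurable _ T `<=` <<s G >> -> (forall A, G A -> K \1_A) ->
  forall A, measurable A -> K \1_A.
Proof.
move=> GI Gm mG KG A mA.
suff : <<s G >> `<=` [set A | measurable A /\ K \1_A].
  by move=> /(_ A (mG A mA))[].
apply: lambda_system_subset => //.
- split => //.
  + by split => //; rewrite indicT.
  + move=> B C CB [mB KB] [mC KC]; split; first exact: measurableD.
    have := K_lin (-1) _ _ KC KB; congr K; apply/funext => t.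
    rewrite !indicE in_setD mulN1r addrC; case: (boolP (t \in C)) => tC.
      by rewrite (mem_set (CB _ (set_mem tC))) subrr.
    by rewrite andbT subr0.
  + move=> F ndF KF; have mF : measurable (\bigcup_i F i).
      by apply: bigcupT_measurable => i; have [] := KF i.
    split => //; rewrite indic_complex.
    apply: (K_dominated (fun n => \1_(F n))).
    * by rewrite -indic_complex; exact: L2_indic.
    * by move=> n; apply: measurable_indic; have [] := KF n.
    * move=> n t; rewrite !indicE ler0n ler_nat/=.
      case: (boolP (t \in F n)) => //; rewrite in_setE => Fnt.
      by rewrite (mem_set (_ : (\bigcup_i F i) t))//; exists n.
    * move=> t; rewrite indicE; case: (boolP (t \in _)); rewrite ?notin_setE ?in_setE.
        move=> [n _ Fnt]; apply: cvg_near_cst; near=> m.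
        have /subsetPset FnFm : (F n <= F m)%O.
          by apply: ndF; near: m; exact: nbhs_infty_ge.
        by rewrite indicE mem_set//; exact: FnFm.
      move=> nF; apply: cvg_near_cst; near=> m.
      by rewrite indicE memNset// => Fm; apply: nF; exists m.
    * by move=> n; rewrite -indic_complex; have [] := KF n.
- by move=> B GB; split; [exact: Gm|exact: KG].
Unshelve. all: by end_near. Qed.

(** The standard ladder: from indicators to simple functions by linearity, to nonnegative functions
    by increasing approximation, to real functions by positive and negative parts, and to complex
    ones by real and imaginary parts. *)
Lemma L2_sub_closed_subspace (G : set (set T)) : setI_closed G ->
  G `<=` measurable -> @measurable _ T `<=` <<s G >> -> (forall A, G A -> K \1_A) -> L2 mu `<=` K.
Proof.
move=> GI Gm mG KG.
have Ki := K_indic _ GI Gm mG KG.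
have Ks (s : {nnsfun T >-> R}) : K (fun t => (s t)%:C).
  have -> : (fun t => (s t)%:C) = (fun t =>
     \sum_(y <- finmap.enum_fset (fset_set (range s))) y%:C * \1_(s @^-1` [set y]) t).
    apply/funext => t; rewrite fimfunE fsbig_finite//= rmorph_sum/=.
    by apply: eq_bigr => y _; rewrite rmorphM/= indic_complex.
  by apply: K_sum => y; apply: KZ; apply: Ki; exact: measurable_sfunP.
have Kp f : (forall t, 0 <= f t) -> L2 mu (fun t => (f t)%:C) ->
    K (fun t => (f t)%:C).
  move=> f0 Lf; have [mf _ _] := Lf.
  have mEf : measurable_fun setT (EFin \o f) by exact/measurable_EFinP.
  pose s := nnsfun_approx measurableT mEf.
  have cs t : s n t @[n --> \oo] --> f t.
    have := @cvg_nnsfun_approx _ _ _ _ measurableT _ mEf _ t I.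
    by move=> /(_ (fun t _ => f0 t)) /fine_cvgP[].
  apply: (K_dominated s) => // n t.
  rewrite fun_ge0/= -(cvg_lim _ (cs t))//.
  apply: nondecreasing_cvgn_le; last by apply/cvg_ex; exists (f t).
  by move=> m p mp; have /lefP := @nd_nnsfun_approx _ _ _ _ measurableT _ mEf _ _ mp.
have Kr f : L2 mu (fun t => (f t)%:C) -> K (fun t => (f t)%:C).
  move=> Lf; have [mf _ _] := Lf.
  have -> : (fun t => (f t)%:C) =
      (fun t => -1 * (f^\- t)%:C + (f^\+ t)%:C).
    by apply/funext => t; rewrite mulN1r addrC -rmorphB/= -[in LHS](funrposBneg f).
  apply: K_lin; apply: Kp => //.
  - apply: L2_le_real Lf (measurable_funrneg mf) _ => t.
    rewrite sqmod_real /funrneg; case: (leP (- f t) 0) => _; last by rewrite sqrrN.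
    by rewrite expr0n sqr_ge0.
  - apply: L2_le_real Lf (measurable_funrpos mf) _ => t.
    rewrite sqmod_real /funrpos; case: (leP (f t) 0) => // _.
    by rewrite expr0n sqr_ge0.
move=> F LF; have [m1 m2 _] := LF.
have -> : F = (fun t => 'i * (complex.Im (F t))%:C + (complex.Re (F t))%:C).
  by apply/funext => t; rewrite addrC -complexE.
apply: K_lin; apply: Kr.
- by apply: L2_le_real LF m2 _ => t; rewrite /sqmod lerDr sqr_ge0.
- by apply: L2_le_real LF m1 _ => t; rewrite /sqmod lerDl sqr_ge0.
Qed.

End L2Density.

(** * Shadows of vertices as a generating pi-system on the boundary *)

Section Shadows.
Context {R : realType} {d : nat} (hd : (1 < d)%N).
Implicit Types (x u : tree d) (w : boundary hd).

Lemma shadowP x w : shadow hd x w <-> mkseq w (size x) = x.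
Proof.
split=> [[n <-]|wx]; last by exists (size x).
by rewrite size_mkseq.
Qed.

Lemma shadow_nil : shadow hd [::] = setT.
Proof. by apply/seteqP; split => // w _; apply/shadowP. Qed.

Lemma shadow_cat x u w : shadow hd (x ++ u) w -> shadow hd x w.
Proof.
move=> /shadowP h; apply/shadowP.
have /(congr1 (take (size x))) := h.
rewrite take_size_cat// size_cat => e.
by rewrite -[RHS]e /mkseq -map_take take_iota (minn_idPl (leq_addr _ _)).
Qed.

(** Two vertices on one path are truncations of that path. Together with [shadow_cat], this makes
    any two shadows nested or disjoint. *)
Lemma shadow_prefix x u w : shadow hd x w -> shadow hd u w ->
  (size x <= size u)%N -> prefix x u.
Proof.
move=> /shadowP xw /shadowP uw xu; apply/prefixP; exists (drop (size x) u).
rewrite -[LHS](cat_take_drop (size x)); congr cat.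
by rewrite -[in LHS]uw /mkseq -map_take take_iota (minn_idPl xu).
Qed.

Lemma measurable_shadow x : measurable (shadow hd x).
Proof. by apply: sub_gen_smallest; exists x. Qed.

(* Disjoint shadows exist, so closure under intersection needs the empty set. *)
Definition shadow0 : set (set (boundary hd)) := range (shadow hd) `|` [set set0].

Lemma shadow0_setI : setI_closed shadow0.
Proof.
have H x u : (size x <= size u)%N -> shadow0 (shadow hd x `&` shadow hd u).
  move=> xu; have [/prefixP[v ->]|nxu] := boolP (prefix x u).
    left; exists (x ++ v) => //; apply/seteqP; split => [w|w []//].
    by move=> h; split => //; exact: shadow_cat h.
  right; apply/seteqP; split => // w [xw uw].
  by move: nxu; rewrite (shadow_prefix _ _ _ xw uw xu).
move=> A B [[x _ <-]|->]; last by move=> _; rewrite set0I; right.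
move=> [[u _ <-]|->]; last by rewrite setI0; right.
by case: (leqP (size x) (size u)) => [/H//|/ltnW/H]; rewrite setIC.
Qed.

Lemma shadow_childP x j w :
  shadow hd (child x j) w <-> shadow hd x w /\ w (size x) = j.
Proof.
rewrite !shadowP size_rcons mkseqS; split => [/rcons_inj[-> ->]//|[-> ->]//].
Qed.

Lemma sum_shadow_child x w :
  \sum_(j < d) \1_(shadow hd (child x j)) w = \1_(shadow hd x) w :> R[i].
Proof.
rewrite [RHS]indicE; case: (boolP (w \in _)); rewrite ?notin_setE ?in_setE => xw.
  rewrite (bigD1 (w (size x)))//= indicE mem_set ?big1 ?addr0//; last first.
    by apply/shadow_childP.
  move=> j jw; rewrite indicE memNset// => /shadow_childP[_ wj].
  by move: jw; rewrite -wj eqxx.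
by rewrite big1// => j _; rewrite indicE memNset// => /shadow_childP[].
Qed.

End Shadows.

(** * Orthogonality relations between shadows, branch functions and increments *)

Section ShadowPairing.
Context {R : realType} {d : nat} {hd : (1 < d)%N}.
Variable mu : probability (boundary hd) R.
Hypothesis hmu : forall x : tree d, mu (shadow hd x) = ((d%:R ^+ size x)^-1)%:E.
Implicit Types (x u v y : tree d) (a : 'I_d -> R[i]).

Lemma L2_shadow x : L2 mu (\1_(shadow hd x) : boundary hd -> R[i]).
Proof. exact: L2_indic mu _ (measurable_shadow hd x). Qed.

Lemma cpair_indic (A B : set (boundary hd)) : measurable A -> measurable B ->
  cpair mu \1_A \1_B = (fine (mu (A `&` B)))%:C.
Proof.
move=> mA mB; rewrite /cpair /cintegral.
congr (_ +i* _).
  rewrite -[A `&` B]setIT -integral_indic//; last exact: measurableI.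
  congr fine; apply: eq_integral => t _.
  by rewrite !indicE in_setI; case: (t \in A); case: (t \in B) => /=; simpc.
rewrite (@eq_Rintegral _ _ _ _ _ (fun=> 0)) ?Rintegral_cst ?mul0r// => t _.
by rewrite !indicE; case: (t \in A); case: (t \in B) => /=; simpc.
Qed.

Lemma cpair_shadow u v : (size u <= size v)%N ->
  cpair mu \1_(shadow hd u) \1_(shadow hd v) =
  (prefix u v)%:R / (d%:R ^+ size v).
Proof.
move=> uv; rewrite cpair_indic; [|exact: measurable_shadow..].
case: (boolP (prefix u v)) => [/prefixP[w ->]|nuv].
  rewrite (_ : _ `&` _ = shadow hd (u ++ w)).
    by rewrite hmu/= mul1r fmorphV rmorphXn/= rmorph_nat.
  by apply/seteqP; split => [t []//|t h]; split => //; exact: shadow_cat h.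
rewrite (_ : _ `&` _ = set0) ?measure0 ?mul0r//.
apply/seteqP; split => // t [ut vt].
by move: nuv; rewrite (shadow_prefix _ _ _ _ ut vt uv).
Qed.

(** These are the elements of B_x when [a] sums to zero; that condition is left to the lemmas
    relying on it. *)
Definition branch x a : boundary hd -> R[i] :=
  fun w => \sum_(j < d) a j * \1_(shadow hd (child x j)) w.

Lemma L2_branch x a : L2 mu (branch x a).
Proof. by apply: L2_sum => j; apply: L2Z; exact: L2_shadow. Qed.

Lemma cpair_shadow_branch u x a : cpair mu \1_(shadow hd u) (branch x a) =
  \sum_(j < d) a j * cpair mu \1_(shadow hd u) \1_(shadow hd (child x j)).
Proof.
rewrite cpair_sumr; [|exact: L2_shadow|by move=> j; apply: L2Z; exact: L2_shadow].
by apply: eq_bigr => j _; rewrite cpairZr//; exact: L2_shadow.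
Qed.

(** At this depth the shadow of [u] contains either all the shadows of the children of [x] or none
    of them, so the pairing is a multiple of the sum of the [a j]. *)
Lemma cpair_shadow_branch_le u x a : \sum_(j < d) a j = 0 ->
  (size u <= size x)%N -> cpair mu \1_(shadow hd u) (branch x a) = 0.
Proof.
move=> a0 ux; rewrite cpair_shadow_branch.
rewrite (eq_bigr (fun j => a j * ((prefix u x)%:R / d%:R ^+ (size x).+1))).
  by rewrite -mulr_suml a0 mul0r.
move=> j _; rewrite cpair_shadow ?size_rcons ?(leqW ux)//.
congr (_ * (_%:R / _)); congr nat_of_bool.
by rewrite !prefixE /child -cats1 takel_cat.
Qed.

Lemma cpair_shadow_branch_gt u x a : (size x < size u)%N ->
  cpair mu \1_(shadow hd u) (branch x a) =
  \sum_(j < d) a j * ((prefix (child x j) u)%:R / d%:R ^+ size u).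
Proof.
move=> xu; rewrite cpair_shadow_branch; apply: eq_bigr => j _.
by rewrite cpairC cpair_shadow// size_rcons.
Qed.

Lemma prefix_child x j u : prefix (child x j) u ->
  (size x < size u)%N /\ prefix x u.
Proof.
by move=> /prefixP[v ->]; rewrite size_cat size_rcons leq_addr cat_rcons
  prefix_prefix.
Qed.

Lemma prefix_child_cat x j m v : prefix (child x j) (child x m ++ v) = (j == m).
Proof.
rewrite prefixE !size_rcons take_size_cat ?size_rcons//.
by rewrite eqseq_rcons eqxx/= eq_sym.
Qed.

Lemma sum_prefix_child (f : 'I_d -> R[i]) x m v :
  \sum_(j < d) f j * (prefix (child x j) (child x m ++ v))%:R = f m.
Proof.
rewrite (bigD1 m)//= prefix_child_cat eqxx mulr1 big1 ?addr0// => j jm.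
by rewrite prefix_child_cat (negPf jm) mulr0.
Qed.

(** For 0 < i <= |y| this is the orthogonal projection of the indicator of the shadow of y_i onto
    B_x with x = y_(i-1). *)
Definition increment y i : boundary hd -> R[i] := fun w =>
  \1_(shadow hd (ancestor y i)) w
  - d%:R^-1 * \1_(shadow hd (ancestor y i.-1)) w.

Lemma L2_increment y i : L2 mu (increment y i).
Proof. by apply: L2B; [|apply: L2Z]; exact: L2_shadow. Qed.

Lemma cpair_increment F y i : L2 mu F ->
  cpair mu F (increment y i) = cpair mu F \1_(shadow hd (ancestor y i))
    - d%:R^-1 * cpair mu F \1_(shadow hd (ancestor y i.-1)).
Proof.
move=> LF; rewrite cpairBr ?cpairZr//; [exact: L2_shadow|exact: L2_shadow|].
by apply: L2Z; exact: L2_shadow.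
Qed.

Lemma size_ancestor y i : (i <= size y)%N -> size (ancestor y i) = i.
Proof. exact: size_takel. Qed.

(** Each ancestor of [y] is either no deeper than [x], or has no child of [x] as a prefix; in both
    cases its shadow is orthogonal to the branch function. *)
Lemma cpair_branch_increment0 x a y i : \sum_(j < d) a j = 0 ->
  ~~ ((size x < size y)%N && prefix x y) ->
  cpair mu (branch x a) (increment y i) = 0.
Proof.
move=> a0 nxy; rewrite cpair_increment; last exact: L2_branch.
suff H k : cpair mu (branch x a) \1_(shadow hd (ancestor y k)) = 0.
  by rewrite !H mulr0 subr0.
rewrite cpairC; case: (leqP (size (ancestor y k)) (size x)) => [|h].
  exact: cpair_shadow_branch_le.
rewrite cpair_shadow_branch_gt// big1// => j _.
case: (boolP (prefix _ _)); rewrite ?mul0r ?mulr0// => /prefix_child[h1 h2].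
case/negP: nxy; apply/andP; split.
  by apply: leq_trans h1 _; rewrite /ancestor size_take_min geq_minr.
exact: prefix_trans h2 (prefix_take _ _).
Qed.

(** The pairing with the shadow of the ancestor at level k is 0 for k <= |x| and a_m / d^k beyond.
    The factor 1/d in the increment makes consecutive values cancel, except at the jump i = |x| +
    1. *)
Lemma cpair_branch_increment x a m v i : \sum_(j < d) a j = 0 ->
  (0 < i)%N -> (i <= size (child x m ++ v))%N ->
  cpair mu (branch x a) (increment (child x m ++ v) i) =
  (i == (size x).+1)%:R * (a m / d%:R ^+ i).
Proof.
move=> a0 i0 ile; rewrite cpair_increment; last exact: L2_branch.
set y := child x m ++ v in ile *.
have le k : (k <= size x)%N ->
    cpair mu (branch x a) \1_(shadow hd (ancestor y k)) = 0.
  move=> kx; rewrite cpairC cpair_shadow_branch_le//.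
  by rewrite /ancestor size_take_min; exact: leq_trans (geq_minl _ _) kx.
have gt k : (size x < k <= size y)%N ->
    cpair mu (branch x a) \1_(shadow hd (ancestor y k)) = a m / d%:R ^+ k.
  move=> /andP[xk ky]; rewrite cpairC cpair_shadow_branch_gt ?size_ancestor//.
  under eq_bigr do rewrite mulrA.
  rewrite -mulr_suml /ancestor /y take_cat size_rcons ltnNge xk/=.
  by rewrite sum_prefix_child.
case: (ltngtP i (size x).+1) => [ix|ix|->].
- by rewrite !le ?mulr0 ?subr0 ?mul0r// ?(leq_trans (leq_pred _)).
- rewrite !gt ?ix ?ile ?(ltnW ix)//=; last first.
    by rewrite -ltnS prednK// ix/= (leq_trans (leq_pred _)).
  rewrite mul0r; case: i i0 ix ile => //= i _ _ _.
  by rewrite exprS invfM [d%:R^-1 * _]mulrCA subrr.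
- by rewrite gt ?le ?mulr0 ?subr0 ?mul1r//= ltnSn size_cat size_rcons leq_addr.
Qed.

(** Each step down the tree divides the mass of the shadow by d, so increments have mean zero. *)
Lemma cpair_1_increment y i : (0 < i)%N -> (i <= size y)%N ->
  cpair mu (fun=> 1) (increment y i) = 0.
Proof.
move=> i0 iy; rewrite -[X in cpair _ X](_ : \1_(shadow hd [::]) = _); last first.
  by rewrite shadow_nil indicT.
rewrite cpair_increment; last exact: L2_shadow.
rewrite !cpair_shadow// !prefix0s !size_ancestor//; last first.
  exact: leq_trans (leq_pred _) iy.
case: i i0 iy => //= i _ _; rewrite !mul1r exprS invfM subrr//.
Qed.

End ShadowPairing.

(** * Point evaluation on l2 and the square of the L2 norm *)

Section L2norm.
Context {R : realType}.

Lemma sqmod_le_l2norm (T : choiceType) (u : T -> R[i]) t :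
  l2 u -> sqmod (u t) <= l2norm u ^+ 2.
Proof.
move=> lu; rewrite /l2norm sqr_sqrtr; last first.
  by apply: fine_ge0; apply: esum_ge0 => s _; rewrite lee_fin sqmod_ge0.
rewrite -lee_fin fineK; last first.
  rewrite ge0_fin_numE//; apply: esum_ge0 => s _; rewrite lee_fin sqmod_ge0//.
apply: esum_ge; exists [set t]; first by split.
by rewrite fsbig_set1.
Qed.

Lemma sqr_L2norm (disp : measure_display) (T : measurableType disp)
  (mu : {measure set T -> \bar R}) (F : T -> R[i]) :
  L2norm mu F ^+ 2 = \int[mu]_t sqmod (F t).
Proof.
by rewrite sqr_sqrtr//; apply: Rintegral_ge0 => t _; exact: sqmod_ge0.
Qed.

End L2norm.

(** * Evaluation of the isometry through the explicit kernel *)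

Section Kernel.
Context {R : realType} {d : nat} {hd : (1 < d)%N} {lam bet : nat -> R} {z : R[i]}.
Variable mu : probability (boundary hd) R.
Hypothesis hmu : forall x : tree d, mu (shadow hd x) = ((d%:R ^+ size x)^-1)%:E.
Variable U : (boundary hd -> R[i]) -> (tree d -> R[i]).
Hypothesis hU : boundary_isometry lam bet z mu U.
Implicit Types (x y u v : tree d) (F G : boundary hd -> R[i]).

Let f : tree d -> tree d -> R[i] := ftree lam bet z.
Let alpha := alpha d lam bet z.

Lemma ftree_id x : f x x = 1.
Proof. by rewrite /f /ftree prefix_refl subnn. Qed.

(** The value 1 at [x] bounds the norm from below. Square summability matters because [fine] sends
    an infinite sum to 0. *)
Lemma alpha_neq0 x : l2 (f x) -> alpha (size x) != 0.
Proof.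
move=> /(sqmod_le_l2norm _ _ x); rewrite ftree_id alphaE => h.
apply/eqP; rewrite /alpha => a0; move: h.
by rewrite a0 /sqmod/= expr1n !expr0n/= addr0 ler10.
Qed.

Lemma l2_ftree_nil : l2 (f [::]).
Proof.
rewrite /f -(bi_root hU); apply: (bi_range hU _).1.
by apply: L2Z; rewrite indicT; exact: L2_1.
Qed.

(* The difference of two siblings' functions is in the range of U, and their
   supports are disjoint. *)
Lemma l2_ftree_child x j : l2 (f (child x j)).
Proof.
(* A second label, which exists because d >= 2: it is 1 if [j] is 0, and 0 otherwise. *)
pose j' : 'I_d := if (j == 0 :> nat)%N then Ordinal hd else Ordinal (ltnW hd).
have jj' : j' != j.
  by rewrite /j' -val_eqE/=; case: ifP => [/eqP->|/negbT]; rewrite // eq_sym.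
pose a (k : 'I_d) : R[i] := (k == j)%:R - (k == j')%:R.
have sum1 (k0 : 'I_d) : \sum_(k < d) ((k == k0)%:R : R[i]) = 1.
  by rewrite (bigD1 k0)//= eqxx big1 ?addr0// => k /negPf->.
have a0 : \sum_k a k = 0 by rewrite sumrB !sum1 subrr.
have := bi_branch hU x a0.
set G := (fun w => _ : R[i]) => UG.
have : l2 (U G) by apply: (bi_range hU _).1; apply: L2Z; exact: L2_branch.
rewrite UG; apply: le_lt_trans; apply: le_esum => y _; rewrite lee_fin.
rewrite /f {1}/ftree; case: (boolP (prefix _ y)) => [/prefixP[v yE]|_]; last first.
  by rewrite sqmod0 sqmod_ge0.
rewrite (bigD1 j)//= big1 ?addr0.
  by rewrite /a eqxx eq_sym (negPf jj') subr0 mul1r /ftree yE prefix_prefix.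
by move=> k kj; rewrite /ftree yE prefix_child_cat (negPf kj) mulr0.
Qed.

Lemma alphaC_neq0 n : (alpha n)%:C != 0.
Proof.
rewrite fmorph_eq0; case: n => [|n].
  by have := alpha_neq0 [::] l2_ftree_nil.
pose i0 : 'I_d := Ordinal (ltnW hd).
have := alpha_neq0 _ (l2_ftree_child (nseq n i0) i0).
by rewrite size_rcons size_nseq.
Qed.

Lemma boundary_isometry0 : U (fun=> 0) = fun=> 0.
Proof.
have := bi_linear hU (-1) (L2_0 mu) (L2_0 mu).
under [X in U X]eq_fun do rewrite mulr0 addr0.
by move=> ->; apply/funext => y; rewrite mulN1r addNr.
Qed.

Lemma boundary_isometryZ c F : L2 mu F ->
  U (fun w => c * F w) = fun y => c * U F y.
Proof.
move=> LF; have := bi_linear hU c LF (L2_0 mu).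
rewrite boundary_isometry0 => h.
transitivity (fun y => c * U F y + 0); last by apply/funext => y; rewrite addr0.
by rewrite -h; congr U; apply/funext => w; rewrite addr0.
Qed.

Lemma boundary_isometryB F G y : L2 mu F -> L2 mu G ->
  U (fun w => F w - G w) y = U F y - U G y.
Proof.
move=> LF LG; have /(congr1 (@^~ y))/= := bi_linear hU (-1) LG LF.
by rewrite mulN1r addrC => <-; congr (U _ y); apply/funext => w;
  rewrite mulN1r addrC.
Qed.

Definition kernel_coef y i : R[i] :=
  f (ancestor y i) y / (alpha i)%:C * (Num.sqrt (d%:R ^+ i))%:C.

Definition kernel_sum y : boundary hd -> R[i] := fun w =>
  f [::] y / (alpha 0)%:C * \1_[set: boundary hd] w
  + \sum_(1 <= i < (size y).+1) kernel_coef y i * increment y i w.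

Lemma L2_indicT : L2 mu (\1_[set: boundary hd] : _ -> R[i]).
Proof. by rewrite indicT; exact: L2_1. Qed.

Lemma L2_kernel_sum y : L2 mu (kernel_sum y).
Proof.
apply: L2_lin; first exact: L2_indicT.
by apply: L2_sum => i; apply: L2Z; exact: L2_increment.
Qed.

Lemma cpair_kernel_sum y F : L2 mu F -> cpair mu (kernel_sum y) F =
  f [::] y / (alpha 0)%:C * cpair mu F (fun=> 1)
  + \sum_(1 <= i < (size y).+1) kernel_coef y i * cpair mu F (increment y i).
Proof.
move=> LF; have LZ i : L2 mu (fun w => kernel_coef y i * increment y i w).
  by apply: L2Z; exact: L2_increment.
rewrite cpairC cpair_linr//; [|exact: L2_indicT|exact: L2_sum].
rewrite indicT cpair_sumr//; congr (_ + _); apply: eq_bigr => i _.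
by rewrite cpairZr//; exact: L2_increment.
Qed.

Lemma boundary_isometry_1 y : U (fun=> 1) y = cpair mu (kernel_sum y) (fun=> 1).
Proof.
rewrite cpair_kernel_sum; last exact: L2_1.
rewrite [X in _ + X]big_nat big1 ?addr0; last first.
  by move=> i /andP[i0 iy]; rewrite cpair_1_increment// mulr0.
have := bi_root hU; rewrite indicT boundary_isometryZ; last exact: L2_1.
move=> /(congr1 (@^~ y))/=; rewrite -/f -/alpha => <-.
rewrite [(alpha 0)%:C * _]mulrC mulfK ?alphaC_neq0//.
have := cpair_shadow mu hmu [::] [::] isT.
by rewrite shadow_nil indicT expr0 divr1 => ->; rewrite mulr1.
Qed.

(** At [y] only the child of [x] on the path to [y] contributes to the left side, and only the
    increment of index |x| + 1 to the right side. Both sides vanish if [y] is not strictly below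
    [x]. *)
Lemma boundary_isometry_branch y x (a : 'I_d -> R[i]) : \sum_(j < d) a j = 0 ->
  U (branch x a) y = cpair mu (kernel_sum y) (branch x a).
Proof.
move=> a0; set k := (size x).+1.
(* The normalization in [bi_branch]; the identity is proved after multiplication by it. *)
pose c : R[i] := (alpha k)%:C * (Num.sqrt (d%:R ^+ k))%:C.
have d0 : d%:R != 0 :> R[i] by rewrite pnatr_eq0 -lt0n ltnW.
have sd : (Num.sqrt (d%:R ^+ k : R))%:C * (Num.sqrt (d%:R ^+ k))%:C = d%:R ^+ k.
  by rewrite -rmorphM -expr2 sqr_sqrtr ?exprn_ge0// rmorphXn/= rmorph_nat.
have s0 : (Num.sqrt (d%:R ^+ k : R))%:C != 0.
  by move: (expf_neq0 k d0); rewrite -sd mulf_eq0 negb_or => /andP[].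
have c0 : c != 0 by rewrite mulf_neq0// alphaC_neq0.
apply: (mulfI c0).
have /(congr1 (@^~ y))/= := bi_branch hU x a0.
rewrite rmorphM -/alpha -/k -/c -/(branch x a) boundary_isometryZ; last exact: L2_branch.
move=> ->; rewrite cpair_kernel_sum; last exact: L2_branch.
rewrite cpairC -[X in cpair _ X](_ : \1_(shadow hd [::]) = _); last first.
  by rewrite shadow_nil indicT.
rewrite cpair_shadow_branch_le// mulr0 add0r.
have [/andP[xy /prefixP[v0 yE]]|nxy] := boolP ((size x < size y)%N && prefix x y).
  have [m [v {}yE]] : exists m v, y = child x m ++ v.
    move: xy; rewrite yE size_cat -{1}[size x]addn0 ltn_add2l.
    by case: v0 {yE} => // m v _; exists m, v; rewrite cat_rcons.
  rewrite [in LHS]yE (eq_bigr (fun j => a j * f (child x m) y *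
    (prefix (child x j) (child x m ++ v))%:R)); last first.
    move=> j _; rewrite prefix_child_cat; case: eqP => [->|/eqP jm].
      by rewrite mulr1 yE.
    by rewrite /ftree prefix_child_cat (negPf jm) !mulr0.
  rewrite sum_prefix_child.
  rewrite (bigD1_seq k) ?mem_index_iota ?iota_uniq//= ?ltnS//.
  rewrite [X in _ + X]big_nat_cond [X in _ + X]big1 ?addr0; last first.
    move=> i /andP[/andP[i0 iy] /negPf ik].
    by rewrite yE cpair_branch_increment -?yE// ik mul0r mulr0.
  rewrite {3}yE cpair_branch_increment -?yE// eqxx mul1r /kernel_coef.
  have -> : ancestor y k = child x m.
    by rewrite yE /ancestor take_size_cat ?size_rcons.
  (* One square root comes from [c] and one from the kernel coefficient; their product d^k cancels
     the mass of the shadow. *)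
  rewrite /c -sd.
  have al0 := alphaC_neq0 k.
  rewrite -/k.
  by field; rewrite al0 s0.
rewrite [in RHS]big1 ?mulr0; last first.
  by move=> i _; rewrite cpair_branch_increment0// mulr0.
rewrite big1// => j _; rewrite /ftree; case: (boolP (prefix _ _)) => [/prefix_child[h1 h2]|].
  by rewrite h1 h2 in nxy.
by rewrite mulr0.
Qed.

Lemma boundary_isometry_shadow y x :
  U \1_(shadow hd x) y = cpair mu (kernel_sum y) \1_(shadow hd x).
Proof.
elim/last_ind: x => [|x i IH]; first by rewrite shadow_nil indicT boundary_isometry_1.
have d0 : d%:R != 0 :> R[i] by rewrite pnatr_eq0 -lt0n ltnW.
(* These coefficients split the indicator of a child's shadow into 1/d times that of its parent plus
   an element of B_x. *)
pose a (k : 'I_d) : R[i] := (k == i)%:R - d%:R^-1.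
have a0 : \sum_k a k = 0.
  rewrite sumrB sumr_const card_ord -[_ *+ d]mulr_natl mulfV//.
  by rewrite (bigD1 i)//= eqxx big1 ?addr0 ?subrr// => k /negPf->.
have -> : \1_(shadow hd (rcons x i)) =
    (fun w => d%:R^-1 * \1_(shadow hd x) w + branch x a w) :> (_ -> R[i]).
  apply/funext => w; rewrite -(sum_shadow_child hd x w) mulr_sumr -big_split/=.
  under eq_bigr do rewrite -mulrDl addrC subrK.
  rewrite (bigD1 i)//= eqxx mul1r big1 ?addr0// => k /negPf->.
  by rewrite mul0r.
rewrite (bi_linear hU); [|exact: L2_shadow|exact: L2_branch].
rewrite cpair_linr; [|exact: L2_kernel_sum|exact: L2_shadow|exact: L2_branch].
by rewrite IH boundary_isometry_branch.
Qed.

Lemma sqmod_boundary_isometry_le F y : L2 mu F ->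
  sqmod (U F y) <= \int[mu]_t sqmod (F t).
Proof.
move=> LF; rewrite -sqr_L2norm -(bi_isometry hU)//.
by apply: sqmod_le_l2norm; exact: (bi_range hU LF).1.
Qed.

Lemma boundary_isometryE y F : L2 mu F -> U F y = cpair mu (kernel_sum y) F.
Proof.
have LQ := L2_kernel_sum y; set Q := kernel_sum y in LQ *.
(* Membership in L2 is kept in the set because linearity of [U] and of the pairing is available only
   there. *)
suff : L2 mu `<=` [set F | L2 mu F /\ U F y = cpair mu Q F].
  by move=> /(_ F) h /h[].
apply: (@L2_sub_closed_subspace _ _ _ _ _ _ _ _ (shadow0 hd)) => {F}.
- by split; [exact: L2_1|exact: boundary_isometry_1].
- move=> c F H [LF UF] [LH UH]; split; first exact: L2_lin.
  by rewrite (bi_linear hU)// cpair_linr// UF UH.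
- move=> F LF h; split => //; apply/eqP; rewrite -subr_eq0; apply/eqP.
  apply: sqmod_eq0; apply/eqP; rewrite eq_le sqmod_ge0 andbT.
  set S := \int[mu]_t sqmod (Q t).
  have S0 : 0 <= S by apply: Rintegral_ge0 => t _; exact: sqmod_ge0.
  apply/ler_addgt0Pr => e e0; rewrite add0r.
  (* [sqmodD_le] doubles both bounds for the error F - H: its squared norm I for [U], and 2 (S + 1)
     I for the pairing. *)
  pose C := 2 + 4 * (S + 1); have C0 : 0 < C by rewrite /C; lra.
  have [|H [[LH UH] _ FH]] := h (e / C); first by rewrite divr_gt0.
  have LD := L2B mu _ _ LF LH.
  have FH' : \int[mu]_t sqmod (F t - H t) <= e / C.
    rewrite -lee_fin fineK//.
    exact: (integrable_fin_num measurableT (L2_sqmod_integrable mu _ LD)).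
  have -> : U F y - cpair mu Q F = U (fun w => F w - H w) y
      - cpair mu Q (fun w => F w - H w).
    by rewrite boundary_isometryB// cpairBr// UH opprB addrA subrK.
  apply: le_trans (sqmodD_le _ _) _.
  rewrite sqmodN; have h1 := sqmod_boundary_isometry_le _ y LD.
  have := sqmod_cintegral_le mu _ _ LQ LD; rewrite -/(cpair mu Q _) -/S => h2.
  set I := Rintegral _ _ _ in FH' h1 h2.
  have : C * I <= e by rewrite mulrC -ler_pdivlMr.
  by rewrite /C; lra.
- exact: shadow0_setI.
- by move=> A [[x _ <-]|->]; [exact: measurable_shadow|exact: measurable0].
- by move=> A mA; exact: (@sub_sigma_algebra2 _ _ _ _ (@subsetUl _ _ _) _ mA).
- move=> A [[x _ <-]|->]; first by split; [exact: L2_shadow|exact: boundary_isometry_shadow].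
  rewrite indic0; split; first exact: L2_0.
  by rewrite boundary_isometry0 cpair0r.
Qed.

End Kernel.

(** * Identification of the Poisson kernel up to null sets *)

Theorem theorem1p40 (R : realType) (d : nat) (hd : (1 < d)%N)
    (lam bet : nat -> R) (hlam : forall n, 0 < lam n)
    (hJ : ~ essentially_selfadjoint (jacobi_op d lam bet))
    (z : R[i]) (hz : complex.Im z != 0)
    (mu : probability (boundary hd) R)
    (hmu : forall x : tree d, mu (shadow hd x) = ((d%:R ^+ size x)^-1)%:E)
    (U : (boundary hd -> R[i]) -> (tree d -> R[i]))
    (hU : boundary_isometry lam bet z mu U)
    (y : tree d) (P : boundary hd -> R[i]) (hP : L2 mu P) :
  poisson_kernel mu U y P <->
  {ae mu, forall w : boundary hd, P w =
     ftree lam bet z [::] y / (alpha d lam bet z 0)%:C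
       * \1_[set: boundary hd] w
     + \sum_(1 <= i < (size y).+1)
         ftree lam bet z (ancestor y i) y / (alpha d lam bet z i)%:C
         * (Num.sqrt (d%:R ^+ i))%:C
         * (\1_(shadow hd (ancestor y i)) w
            - d%:R^-1 * \1_(shadow hd (ancestor y i.-1)) w)}.
Proof.
pose Q : boundary hd -> R[i] := kernel_sum (lam := lam) (bet := bet) (z := z) y.
have LQ : L2 mu Q := L2_kernel_sum mu y.
have UQ F : L2 mu F -> U F y = cpair mu Q F := boundary_isometryE mu hmu U hU y F.
suff : poisson_kernel mu U y P <-> {ae mu, forall w, P w = Q w} by [].
split=> [[_ UP]|PQ].
  have LD := L2B mu _ _ hP LQ; have LC := L2_conj mu _ LD.
  have E : cpair mu (fun w => P w - Q w) (fun w => conjc (P w - Q w)) = 0.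
    by rewrite cpairC cpairBr// ![cpair mu (fun _ => conjc _) _]cpairC -UQ//
      /cpair -UP// subrr.
  have := L2_ae_eq0 mu _ LD; rewrite -Re_cpair_conj E => /(_ erefl).
  by apply: filterS => w /eqP; rewrite subr_eq0 => /eqP.
split=> // F LF; rewrite UQ//; apply: ae_eq_cintegral.
- exact: L2_mul_cintegrable.
- exact: L2_mul_cintegrable.
- by apply: filterS PQ => w ->.
Qed.
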